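(* $\mathrm{TCP}^{\natural}$ is reactively Turing powerful modulo divergence-preserving branching bisimilarity: for every reactive Turing machine $\mathcal{M}$ there is a closed $\mathrm{TCP}^{\natural}$ process expression $P$ such that $\mathcal{T}(\mathcal{M})$ and $\mathcal{T}(P)$ are divergence-preserving branching bisimilar.
   Context: Let $\mathcal{A}_\tau=\mathcal{A}\cup\{\tau\}$ be a finite set of actions of interest ($\tau$ internal); the process calculus may additionally use communication actions $c?d$, $c!d$ for channels $c$ from a set $\mathcal{C}$ and data $d$, where $\mathcal{I}_{\mathcal{C}'}=\{c?d,c!d\mid c\in\mathcal{C}'\}$. $\mathrm{TCP}^{\natural}$ expressions (no recursion/names): $P::=\mathbf{0}\mid\mathbf{1}\mid a.P\mid P\bullet P\mid P+P\mid[P\parallel P]_{\mathcal{C}'}\mid P^{*}\mid P\,\sharp\,P$. Operational semantics (structural, with the negative premise well-defined by induction on terms): $\mathbf{1}\downarrow$; $a.P\xrightarrow{a}P$; $+$ inherits transitions and termination from either summand; $P_1\bullet P_2\downarrow$ if both terminate; $P_1\xrightarrow{a}P_1'$ implies $P_1\bullet P_2\xrightarrow{a}P_1'\bullet P_2$; if $P_1\downarrow$, $P_2\xrightarrow{a}P_2'$ and $P_1$ has no outgoing transition, then $P_1\bullet P_2\xrightarrow{a}P_2'$; $[P_1\parallel P_2]_{\mathcal{C}'}\xrightarrow{a}[P_1'\parallel P_2]_{\mathcal{C}'}$ if $P_1\xrightarrow{a}P_1'$ and $a\notin\mathcal{I}_{\mathcal{C}'}$ (symmetrically for $P_2$); $[P_1\parallel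 P_2]_{\mathcal{C}'}\downarrow$ if both terminate; $[P_1\parallel P_2]_{\mathcal{C}'}\xrightarrow{\tau}[P_1'\parallel P_2']_{\mathcal{C}'}$ if $c\in\mathcal{C}'$ and one component does $c?d$ and the other $c!d$; $P^*\downarrow$; $P\xrightarrow{a}P'$ implies $P^*\xrightarrow{a}P'\bullet P^*$; $P_1\xrightarrow{a}P_1'$ implies $P_1\sharp P_2\xrightarrow{a}P_1'\bullet(P_1\sharp P_2)\bullet P_1$; $P_2\xrightarrow{a}P_2'$ implies $P_1\sharp P_2\xrightarrow{a}P_2'$; $P_2\downarrow$ implies $P_1\sharp P_2\downarrow$. $\mathcal{T}(P)$: states reachable from $P$, induced transitions, initial state $P$, terminating states those $Q$ with $Q\downarrow$. A reactive Turing machine (RTM) is $\mathcal{M}=(S,\to,\uparrow,\downarrow)$ with finite state set $S$, a finite data set $\mathcal{D}$ extended with blank $\Box$ to $\mathcal{D}_\Box$, finite $\to\subseteq S\times\mathcal{D}_\Box\times\mathcal{A}_\tau\times\mathcal{D}_\Box\times\{L,R\}\times S$ (written $s\xrightarrow{a[d/e]M}t$), initial state $\uparrow$ and final states $\downarrow\subseteq S$. $\mathcal{T}(\mathcal{M})$ has as states configurations $(s,\delta)$ with $\delta$ a tape instance (a word over $\mathcal{D}_\Box\cup\{\check d\mid d\in\mathcal{D}_\Box\}$ with exactly one marked symbol, the head position); transitions $(s,\delta_L\check d\delta_R)\xrightarrow{a}(t,\overleftarrow{\delta_L}e\delta_R)$ iff $s\xrightarrow{a[d/e]L}t$ and $(s,\delta_L\check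 d\delta_R)\xrightarrow{a}(t,\delta_Le\overrightarrow{\delta_R})$ iff $s\xrightarrow{a[d/e]R}t$, where $\overleftarrow{\delta}$ marks the rightmost symbol of $\delta$ (or is $\check\Box$ if $\delta$ is empty) and $\overrightarrow{\delta}$ marks the leftmost symbol (or is $\check\Box$); initial state $(\uparrow,\check\Box)$; terminating states $(s,\delta)$ with $s\in\downarrow$. Divergence-preserving branching bisimulation: write $s\xrightarrow{(a)}t$ for ''$s\xrightarrow{a}t$ or ($a=\tau$ and $s=t$)'', $\to^*$, $\to^+$ for reflexive-transitive and transitive closures of $\xrightarrow{\tau}$; a symmetric relation $R$ such that $sRt$ implies (1) if $s\xrightarrow{a}s'$ then $t\to^*t''\xrightarrow{(a)}t'$ with $sRt''$, $s'Rt'$; (2) if $s\downarrow$ then $t\to^*t'$ with $t'\downarrow$ and $sRt'$; (3) if $s=s_0\xrightarrow{\tau}s_1\xrightarrow{\tau}\cdots$ is infinite with $s_iRt$ for all $i$, then $t\to^+t'$ with $s_iRt'$ for some $i$. Two transition systems are divergence-preserving branching bisimilar if their initial states are related by such a relation on their disjoint union. *)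

(* Defs.v *)
From mathcomp Require Import all_boot.
From Stdlib Require Export Relations.Relation_Operators.

Set Implicit Arguments.
Unset Strict Implicit.
Unset Printing Implicit Defensive.

(** * Transition systems *)

(* Labels range over [option L]; [None] is the internal action tau. *)
Record tsys (L : Type) := TSys {
  state : Type;
  trans : state -> option L -> state -> Prop;
  init : state;
  final : state -> Prop
}.

Section Bisimulation.

Variables (L S : Type) (tr : S -> option L -> S -> Prop) (fin : S -> Prop).

Definition tau_step (s t : S) : Prop := tr s None t.
Definition tau_star : S -> S -> Prop := clos_refl_trans S tau_step.
Definition tau_plus : S -> S -> Prop := clos_trans S tau_step.
Definition opt_step (s : S) (a : option L) (t : S) : Prop :=
  tr s a t \/ (a = None /\ s = t).

Record dp_branching_bisimulation (R : S -> S -> Prop) : Prop := {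
  dpbb_sym : forall s t, R s t -> R t s;
  dpbb_step : forall s t, R s t -> forall a s', tr s a s' ->
    exists t'' t',
      [/\ tau_star t t'', opt_step t'' a t', R s t'' & R s' t'];
  dpbb_final : forall s t, R s t -> fin s ->
    exists t', [/\ tau_star t t', fin t' & R s t'];
  dpbb_div : forall s t, R s t -> forall u : nat -> S,
    u 0 = s -> (forall i, tau_step (u i) (u i.+1)) -> (forall i, R (u i) t) ->
    exists t' i, tau_plus t t' /\ R (u i) t'
}.

End Bisimulation.

Section DisjointUnion.

Variables (L : Type) (T1 T2 : tsys L).

Definition union_trans (x : state T1 + state T2) (a : option L)
    (y : state T1 + state T2) : Prop :=
  match x, y with
  | inl s, inl t => trans s a t
  | inr s, inr t => trans s a t
  | _, _ => False
  end.

Definition union_final (x : state T1 + state T2) : Prop :=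
  match x with inl s => final s | inr s => final s end.

Definition dp_branching_bisimilar : Prop :=
  exists R : state T1 + state T2 -> state T1 + state T2 -> Prop,
    dp_branching_bisimulation union_trans union_final R
    /\ R (inl (init T1)) (inr (init T2)).

End DisjointUnion.

(** * The process calculus *)

(* Non-tau actions: [A] the actions of interest, [C] channels, [D] data. *)
Inductive action (A C D : Type) : Type :=
| Obs of A
| Recv of C & D
| Send of C & D.
Arguments Obs {A C D}.
Arguments Recv {A C D}.
Arguments Send {A C D}.

(* [Par C' P Q] is [P || Q]_{C'}; [Nest P Q] is the nesting P # Q. *)
Inductive proc (A C D : Type) : Type :=
| Zero
| One
| Prefix of option (action A C D) & proc A C D
| Seq of proc A C D & proc A C D
| Alt of proc A C D & proc A C D
| Par of pred C & proc A C D & proc A C D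
| Star of proc A C D
| Nest of proc A C D & proc A C D.
Arguments Zero {A C D}.
Arguments One {A C D}.

Section Semantics.

Variables A C D : Type.

Local Notation label := (option (action A C D)).
Local Notation proc := (proc A C D).

(* Membership of an action in I_{C'}. *)
Definition comm_on (C' : pred C) (a : label) : bool :=
  match a with
  | Some (Recv c _) | Some (Send c _) => C' c
  | _ => false
  end.

Fixpoint pterm (P : proc) : bool :=
  match P with
  | Zero => false
  | One => true
  | Prefix _ _ => false
  | Seq P1 P2 => pterm P1 && pterm P2
  | Alt P1 P2 => pterm P1 || pterm P2
  | Par _ P1 P2 => pterm P1 && pterm P2
  | Star _ => true
  | Nest _ P2 => pterm P2
  end.

(* A recursive function rather than an inductive relation, because the second
   rule for [Seq] has a negative premise. *)
Fixpoint pstep (P : proc) (a : label) (Q : proc) : Prop :=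
  match P with
  | Zero => False
  | One => False
  | Prefix b P1 => a = b /\ Q = P1
  | Seq P1 P2 =>
      (exists P1', pstep P1 a P1' /\ Q = Seq P1' P2)
      \/ [/\ pterm P1, pstep P2 a Q & forall b P1', ~ pstep P1 b P1']
  | Alt P1 P2 => pstep P1 a Q \/ pstep P2 a Q
  | Par C' P1 P2 =>
      [\/ exists P1', [/\ pstep P1 a P1', ~~ comm_on C' a & Q = Par C' P1' P2],
          exists P2', [/\ pstep P2 a P2', ~~ comm_on C' a & Q = Par C' P1 P2']
        | a = None /\ exists c d P1' P2',
            [/\ C' c,
                (pstep P1 (Some (Recv c d)) P1' /\
                 pstep P2 (Some (Send c d)) P2')
                \/ (pstep P1 (Some (Send c d)) P1' /\
                    pstep P2 (Some (Recv c d)) P2')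
              & Q = Par C' P1' P2']]
  | Star P1 => exists P1', pstep P1 a P1' /\ Q = Seq P1' (Star P1)
  | Nest P1 P2 =>
      (exists P1', pstep P1 a P1' /\ Q = Seq P1' (Seq (Nest P1 P2) P1))
      \/ pstep P2 a Q
  end.

Definition reachable : proc -> proc -> Prop :=
  clos_refl_trans proc (fun P Q => exists a, pstep P a Q).

Definition proc_tsys (P : proc) : tsys (action A C D) :=
  @TSys _ {Q : proc | reachable P Q}
    (fun Q a Q' => pstep (sval Q) a (sval Q'))
    (exist _ P (rt_refl _ _ P))
    (fun Q => pterm (sval Q)).

End Semantics.

(** * Reactive Turing machines *)

Inductive move := MoveL | MoveR.

(* [option D] is D with the blank symbol [None]; [option A] is A with tau.
   [rtm_trans s d a e m t] is the transition s --a[d/e]m--> t. *)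
Record rtm (A D : finType) := RTM {
  rtm_state : finType;
  rtm_trans : rtm_state -> option D -> option A -> option D -> move ->
              rtm_state -> bool;
  rtm_init : rtm_state;
  rtm_final : pred rtm_state
}.

Section RTMSemantics.

Variables (A D : finType) (C E : Type) (M : rtm A D).

(* The word deltaL d deltaR with d the marked symbol; both sides are written
   from left to right. *)
Record tape := Tape {
  tape_left : seq (option D);
  tape_head : option D;
  tape_right : seq (option D)
}.

(* The tape instance obtained from the word w1 w2 by marking the rightmost
   symbol of w1, or a fresh blank if w1 is empty. *)
Definition tape_moveL (w1 w2 : seq (option D)) : tape :=
  match w1 with
  | [::] => Tape [::] None w2
  | x :: w => Tape (belast x w) (last x w) w2
  end.

Definition tape_moveR (w1 w2 : seq (option D)) : tape :=
  match w2 with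
  | [::] => Tape w1 None [::]
  | x :: w => Tape w1 x w
  end.

Definition rtm_config : Type := rtm_state M * tape.

Definition rtm_step (x : rtm_config) (a : option A) (y : rtm_config) : Prop :=
  let: (s, Tape l d r) := x in
  exists e t,
    (rtm_trans s d a e MoveL t /\ y = (t, tape_moveL l (e :: r)))
    \/ (rtm_trans s d a e MoveR t /\ y = (t, tape_moveR (rcons l e) r)).

(* Labels are embedded into those of the calculus, with tau going to tau. *)
Definition rtm_tsys : tsys (action A C E) :=
  @TSys _ rtm_config
    (fun x b y => exists a : option A, b = omap Obs a /\ rtm_step x a y)
    (rtm_init M, Tape [::] None [::])
    (fun x => rtm_final x.1).

End RTMSemantics.

(* Main.v *)
(** The contents of the tape on either side of the head are two stacks, encoded as
    numbers in base |D| + 1 with the blank as digit 0, so that popping an empty stack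
    yields a blank.  Nesting provides half-counters, [((a # b) . b)^*]: count up with
    a, switch with b, count down with a, and detect zero with b.  Draining one
    half-counter into another multiplies or divides by the base, so three of them
    with a finite control simulate a head move by a terminating sequence of tau
    steps after the visible action.  A machine configuration is related to all
    process expressions that inevitably reach its encoding by such steps; since
    these sequences are finite, divergence is preserved in both directions. *)

Require Import Defs.
From Stdlib Require Import Setoid Relations.Operators_Properties.
From mathcomp Require Import all_boot.

Set Implicit Arguments.
Unset Strict Implicit.
Unset Printing Implicit Defensive.

(** * Bisimilarity from forced silent steps *)

Section Inevitability.

Variables A C D : Type.
Local Notation proc := (proc A C D).

(** Being inductive, it makes every silent path reach [G] after finitely many steps. Intermediate
    states neither terminate, nor deadlock, nor show an action, so they can be related to the same
    configuration as the [G]-states ahead. *)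
Inductive inev (G : proc -> Prop) : proc -> Prop :=
| inev_now P : G P -> inev G P
| inev_tau P : ~~ pterm P -> (exists P', pstep P None P') ->
    (forall a P', pstep P a P' -> a = None) ->
    (forall P', pstep P None P' -> inev G P') -> inev G P.

Variable T : tsys (action A C D).
Variable G : state T -> proc -> Prop.
Hypothesis G_fwd : forall x P, G x P -> forall a x', trans x a x' ->
  exists2 P', pstep P a P' & inev (G x') P'.
Hypothesis G_bwd : forall x P, G x P -> forall a P', pstep P a P' ->
  exists2 x', trans x a x' & inev (G x') P'.
Hypothesis G_final : forall x P, G x P -> (final x <-> pterm P).

Variable P0 : proc.
Local Notation TP := (proc_tsys P0).
Local Notation utrans := (@union_trans _ T TP).

Lemma reachable_next (Q : state TP) a P' :
  pstep (sval Q) a P' -> exists Q' : state TP, sval Q' = P'.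
Proof.
case: Q => Q rQ /= st.
have rP : reachable P0 P' by apply: (rt_trans _ _ _ _ _ rQ); apply: rt_step; exists a.
by exists (exist _ P' rP).
Qed.

Lemma inev_reach x (Q : state TP) : inev (G x) (sval Q) ->
  exists2 Q' : state TP, tau_star utrans (inr Q) (inr Q') & G x (sval Q').
Proof.
move: {2}(sval Q) (erefl (sval Q)) => P eP iP; rewrite eP in iP.
elim: iP Q eP => {}P => [GP Q eP | _ [P' st] _ _ IH Q eP].
  by exists Q; [exact: rt_refl | rewrite eP].
rewrite -eP in st; have [Q1 eQ1] := reachable_next st.
rewrite -eQ1 in st; rewrite eP in st.
have [Q' t1 GQ'] := IH _ st _ (erefl _).
exists Q' => //; apply: rt_trans t1; apply: rt_step.
by rewrite /tau_step /= eP.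
Qed.

Definition union_rel (s t : state T + state TP) : Prop :=
  match s, t with
  | inl x, inr Q | inr Q, inl x => inev (G x) (sval Q)
  | _, _ => False
  end.

Lemma union_rel_fwd x (Q : state TP) a x' :
  inev (G x) (sval Q) -> trans x a x' ->
  exists Q1 Q2 : state TP,
    [/\ tau_star utrans (inr Q) (inr Q1), pstep (sval Q1) a (sval Q2),
        inev (G x) (sval Q1) & inev (G x') (sval Q2)].
Proof.
move=> iQ st; have [Q1 t1 GQ1] := inev_reach iQ.
have [P' st' iP'] := G_fwd GQ1 st.
have [Q2 eQ2] := reachable_next st'.
by exists Q1, Q2; rewrite eQ2; split=> //; apply: inev_now.
Qed.

(** By induction on [inev], a silent run spends only finitely many steps on its way to [G]; the step
    leaving a [G]-state is then answered by a step of [T]. *)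
Lemma union_rel_div x (u : nat -> state T + state TP) :
  union_rel (u 0) (inl x) -> (forall i, tau_step utrans (u i) (u i.+1)) ->
  exists t' i, tau_plus utrans (inl x) t' /\ union_rel (u i) t'.
Proof.
case eu: (u 0) => [//|Q] /=.
move: {2}(sval Q) (erefl (sval Q)) => P eP iP; rewrite eP in iP.
elim: iP u Q eu eP => {}P => [GP u Q eu eP | _ _ _ _ IH u Q eu eP] tu;
  have := tu 0; rewrite eu /tau_step; case eu1: (u 1) => [//|Q1] /=; rewrite eP => st.
  have [x' sx iQ] := G_bwd GP st.
  by exists (inl x'), 1; rewrite eu1; split=> //; apply: t_step.
have [t' [i [h1 h2]]] := IH _ st (fun i => u i.+1) Q1 eu1 (erefl _) (fun i => tu i.+1).
by exists t', i.+1.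
Qed.

Lemma inev_bisimilar : inev (G (init T)) P0 -> dp_branching_bisimilar T TP.
Proof.
move=> i0; exists union_rel; split=> //; split.
- by case=> [x|Q] [y|Q'].
- case=> [x|Q] [y|Q'] //= iQ a [x'|Q2] //= st.
  + have [Q1 [Q2 [h1 h2 h3 h4]]] := union_rel_fwd iQ st.
    by exists (inr Q1), (inr Q2); split=> //; left.
  + case: {-1}_ / iQ (erefl (sval Q)) => P.
      move=> GP eP; rewrite -eP in GP; have [x' sx iQ] := G_bwd GP st.
      exists (inl y), (inl x'); split=> //=; [exact: rt_refl | by left |].
      by rewrite -eP; apply: inev_now.
    move=> nt ex only_tau next eP; have ea : a = None by apply: (only_tau _ (sval Q2)); rewrite -eP.
    exists (inl y), (inl y); rewrite ea in st *; split=> /=; [exact: rt_refl | by right | | ].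
      by apply: inev_tau.
    by apply: next; rewrite -eP.
- case=> [x|Q] [y|Q'] //= iQ fx.
    have [Q1 t1 GQ1] := inev_reach iQ; exists (inr Q1); split=> //=.
      by apply/(G_final GQ1).
    exact: inev_now.
  exists (inl y); split=> //; first exact: rt_refl.
  case: {-1}_ / iQ (erefl (sval Q)) => P.
    by move=> GP eP; apply/(G_final GP); rewrite -eP.
  by move=> + _ _ _ eP; rewrite -eP fx.
- case=> [x|Q] [y|Q'] //= iQ u u0 tu ru; last first.
    by apply: union_rel_div => //; rewrite u0.
  (* The first machine step is already answered by at least one process step. *)
  have := tu 0; rewrite u0 /tau_step; case eu1: (u 1) => [x'|//] /= st.
  have [Q1 [Q2 [h1 h2 h3 h4]]] := union_rel_fwd iQ st.
  exists (inr Q2), 1; rewrite eu1; split=> //.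
  by apply: clos_rt_t h1 _; apply: t_step.
Qed.

End Inevitability.

(** * Steps of sequential, interleaved and choice terms *)

Section Steps.

Variables A C D : Type.
Local Notation proc := (proc A C D).
Implicit Types P Q : proc.

Lemma pstep_seq_one P a Q : pstep (Seq One P) a Q <-> pstep P a Q.
Proof.
split=> /= [[[P' [//]] | [_ //]] | st].
by right; split=> // b P' [].
Qed.

(** A left operand with a transition defeats the negative premise, so even a terminating one cannot
    be skipped. *)
Lemma pstep_seq_live P1 P2 a Q : (exists b P', pstep P1 b P') ->
  pstep (Seq P1 P2) a Q <-> exists2 P1', pstep P1 a P1' & Q = Seq P1' P2.
Proof.
move=> [b [P' st]]; split=> /= [[[P1' [h1 h2]] | [_ _ /(_ _ _ st)]] // | [P1' h1 h2]].
  by exists P1'.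
by left; exists P1'.
Qed.

Lemma pstep_par0 P1 P2 a Q :
  pstep (Par pred0 P1 P2) a Q <->
  (exists2 P1', pstep P1 a P1' & Q = Par pred0 P1' P2) \/
  (exists2 P2', pstep P2 a P2' & Q = Par pred0 P1 P2').
Proof.
have nc : ~~ comm_on pred0 a by case: a => [[]|].
split=> /= [[[P' [h _ ->]] | [P' [h _ ->]] | [_ [c [d [? [? [//]]]]]]] | [] [P' h ->]].
- by left; exists P'.
- by right; exists P'.
- by apply: Or31; exists P'.
- by apply: Or32; exists P'.
Qed.

Definition choice (X : Type) (s : seq X) (F : X -> proc) : proc :=
  foldr (fun x P => Alt (F x) P) Zero s.

Lemma pstep_choice (X : eqType) (s : seq X) F a Q :
  pstep (choice s F) a Q <-> exists2 x, x \in s & pstep (F x) a Q.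
Proof.
elim: s => [|x s IH] /=; first by split=> // [[]].
rewrite IH; split=> [[h | [y ys h]] | [y]].
- by exists x; rewrite ?mem_head.
- by exists y; rewrite // inE ys orbT.
- by rewrite inE => /orP[/eqP -> | ys] h; [left | right; exists y].
Qed.

Lemma pterm_choice_prefix (X : Type) (s : seq X) (f : X -> option (action A C D)) F :
  pterm (choice s (fun x => Prefix (f x) (F x))) = false.
Proof. by elim: s. Qed.

End Steps.

(** * Half-counters as nesting terms *)

Section CounterMachine.

Variables (A : eqType) (E : Type) (e0 : E) (Q : countType) (I : finType).

Local Notation label := (option (action A nat E)).
Local Notation proc := (proc A nat E).

(** [inl (inl q)] carries state [q] from control to relay, [inl (inr q)] carries it back, and
    [inr (i, act)] orders action [act] at counter [i]. *)
Local Notation chan := (Q + Q + I * bool)%type.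

Definition send (c : chan) : label := Some (Send (pickle c) e0).
Definition recv (c : chan) : label := Some (Recv (pickle c) e0).

Lemma send_recv_eq c c' n d :
  Some (Send n d) = send c -> Some (Recv n d) = recv c' -> c = c'.
Proof. by move=> [-> _] [/(pcan_inj pickleK)]. Qed.

(* A half-counter: [true] is the counting-up mode, [false] the counting-down mode,
   which can only be left at zero.  Action [true] changes the value by one, action
   [false] switches the mode. *)
Definition cstate := (bool * nat)%type.

Definition cstep (st : cstate) (act : bool) : option cstate :=
  match st, act with
  | (true, n), true => Some (true, n.+1)
  | (true, n), false => Some (false, n)
  | (false, n.+1), true => Some (false, n)
  | (false, 0), false => Some (true, 0)
  | _, _ => None
  end.

(* The summand [One] makes every state of a counter terminating, while the negative
   premise of sequential composition prevents it from being skipped. *)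
Definition copt (i : I) (act : bool) : proc :=
  Alt (Prefix (recv (inr (i, act))) One) One.

(** Each unfolding leaves one more [copt i true] pending on the right. These copies store the value
    and are consumed one by one after [copt i false] ends the nesting. *)
Definition cnest i : proc := Nest (copt i true) (copt i false).

Definition counter i : proc := Star (Seq (cnest i) (copt i false)).

(** Case 1 shows the [One] left by the last increment; the next increment skips it and leaves a new
    one at the innermost position. *)
Fixpoint cup i n : proc :=
  match n with
  | 0 => cnest i
  | 1 => Seq One (Seq (cnest i) (copt i true))
  | n'.+1 => Seq (cup i n') (copt i true)
  end.

Fixpoint cdown i n : proc :=
  if n is n'.+1 then Seq (cdown i n') (copt i true) else One.

(** In [(true, 0)] the leading [One] is the residue of the zero test, so a counter switched back at
    zero is again literally this term. *)
Definition cterm i (st : cstate) : proc :=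
  match st with
  | (true, 0) => Seq One (counter i)
  | (true, n) => Seq (Seq (cup i n) (copt i false)) (counter i)
  | (false, n) => Seq (Seq (cdown i n) (copt i false)) (counter i)
  end.

Lemma pstep_copt i act a P :
  pstep (copt i act) a P <-> a = recv (inr (i, act)) /\ P = One.
Proof. by split=> /= [[] // | ?]; left. Qed.

Lemma pstep_cdown i n a P : pstep (cdown i n) a P <->
  exists2 m, n = m.+1 & a = recv (inr (i, true)) /\ P = cdown i m.
Proof.
elim: n a P => [|[|n] IH] a P; first by split=> // [[]].
  rewrite pstep_seq_one pstep_copt; split=> [[-> ->] | [m [<-] []] //].
  by exists 0.
rewrite pstep_seq_live; last first.
  by exists (recv (inr (i, true))), (cdown i n); apply/IH; exists n.
split=> [[P' /IH [m [->] [-> ->]] ->] | [m [<-] [-> ->]]]; first by exists m.+1.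
by exists (cdown i n) => //; apply/IH; exists n.
Qed.

Lemma pstep_cnest i a P : pstep (cnest i) a P <->
  a = recv (inr (i, true)) /\ P = cup i 1 \/ a = recv (inr (i, false)) /\ P = One.
Proof.
split=> [[[P1' [/pstep_copt [-> ->] ->]] | /pstep_copt [-> ->]] | [] [-> ->]].
- by left.
- by right.
- by left; exists One; split=> //; left.
- by right; left.
Qed.

Lemma pstep_cup i n a P : pstep (cup i n) a P <->
  a = recv (inr (i, true)) /\ P = cup i n.+1 \/
  a = recv (inr (i, false)) /\ P = cdown i n.
Proof.
elim: n a P => [|n IH] a P; first exact: pstep_cnest.
case: n IH => [|n] IH.
  rewrite pstep_seq_one pstep_seq_live; last first.
    by exists (recv (inr (i, true))), (cup i 1); apply/pstep_cnest; left.
  split=> [[P' /pstep_cnest [] [-> ->] ->] | [] [-> ->]]; first by left.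
  - by right.
  - by exists (cup i 1) => //; apply/pstep_cnest; left.
  - by exists One => //; apply/pstep_cnest; right.
rewrite pstep_seq_live; last first.
  by exists (recv (inr (i, true))), (cup i n.+2); apply/IH; left.
split=> [[P' /IH [] [-> ->] ->] | [] [-> ->]]; first by left.
- by right.
- by exists (cup i n.+2) => //; apply/IH; left.
- by exists (cdown i n.+1) => //; apply/IH; right.
Qed.

Lemma pstep_cterm_up i n a P : pstep (cterm i (true, n)) a P <->
  exists2 P', pstep (cup i n) a P' & P = Seq (Seq P' (copt i false)) (counter i).
Proof.
have live m : exists b P', pstep (cup i m) b P'.
  by exists (recv (inr (i, true))), (cup i m.+1); apply/pstep_cup; left.
have eqB a' P' : pstep (Seq (cup i n) (copt i false)) a' P' <->
    exists2 P'', pstep (cup i n) a' P'' & P' = Seq P'' (copt i false).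
  exact: pstep_seq_live.
have eqS : pstep (cterm i (true, n)) a P <->
    exists2 P', pstep (Seq (cup i n) (copt i false)) a P' & P = Seq P' (counter i).
  case: n eqB => [|n] eqB; rewrite [cterm _ _]/=.
    rewrite pstep_seq_one; split=> [[P' [st ->]] | [P' st ->]]; by exists P'.
  apply: pstep_seq_live; have [b [P' st]] := live n.+1.
  by exists b, (Seq P' (copt i false)); apply/eqB; exists P'.
rewrite eqS; split=> [[P' /eqB [P'' st ->] ->] | [P' st ->]]; first by exists P''.
by exists (Seq P' (copt i false)) => //; apply/eqB; exists P'.
Qed.

(** In down mode the pending copies of [copt i true] block the [copt i false] behind them until they
    are used up: this is the zero test. *)
Lemma pstep_cterm i st a P : pstep (cterm i st) a P <->
  exists act st', [/\ a = recv (inr (i, act)), cstep st act = Some st'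
                    & P = cterm i st'].
Proof.
case: st => -[] n.
  rewrite pstep_cterm_up; split=> [[P' /pstep_cup [] [-> ->] ->] | ].
  - by exists true, (true, n.+1).
  - by exists false, (false, n).
  case=> -[] [st' [-> [<-] ->]].
    by exists (cup i n.+1) => //; apply/pstep_cup; left.
  by exists (cdown i n) => //; apply/pstep_cup; right.
case: n => [|n].
  rewrite pstep_seq_live; last first.
    by exists (recv (inr (i, false))), One; rewrite pstep_seq_one; left.
  split=> [[P'] | [] [] [st' [-> // [<-] ->]]].
    rewrite pstep_seq_one => /pstep_copt [-> ->] ->.
    by exists false, (true, 0).
  by exists One => //; rewrite pstep_seq_one; left.
have live : pstep (cdown i n.+1) (recv (inr (i, true))) (cdown i n).
  by apply/pstep_cdown; exists n.
have live2 : pstep (Seq (cdown i n.+1) (copt i false)) (recv (inr (i, true)))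
    (Seq (cdown i n) (copt i false)).
  by left; exists (cdown i n).
rewrite pstep_seq_live; last by exists (recv (inr (i, true))), (Seq (cdown i n) (copt i false)).
split=> [[P'] | [] [] [st' [-> // [<-] ->]]]; last by exists (Seq (cdown i n) (copt i false)).
rewrite pstep_seq_live; last by exists (recv (inr (i, true))), (cdown i n).
move=> [P'' /pstep_cdown [m [<-] [-> ->]] -> ->].
by exists true, (false, n).
Qed.

Lemma pterm_cterm i st : pterm (cterm i st).
Proof.
have up n : pterm (cup i n) by elim: n => [|[|n] IH] //=; rewrite IH.
have dn n : pterm (cdown i n) by elim: n => [|n IH] //=; rewrite IH.
by case: st => -[] [|n] //=; rewrite ?(up n.+1) ?dn.
Qed.

(** * The bank of counters *)

Local Notation cstates := {ffun I -> cstate}.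

Definition upd (v : cstates) (i : I) (st : cstate) : cstates :=
  [ffun k => if k == i then st else v k].

Definition memory (s : seq I) (v : cstates) : proc :=
  foldr (fun i P => Par pred0 (cterm i (v i)) P) One s.

Lemma memory_upd_notin s v i st : i \notin s -> memory s (upd v i st) = memory s v.
Proof.
elim: s => //= k s IH; rewrite inE negb_or => /andP[ik /IH ->].
by rewrite ffunE eq_sym (negbTE ik).
Qed.

Lemma pstep_memory s v a P : uniq s -> pstep (memory s v) a P <->
  exists i act st', [/\ i \in s, a = recv (inr (i, act)),
                       cstep (v i) act = Some st' & P = memory s (upd v i st')].
Proof.
elim: s a P => [|k s IH] a P; first by split=> // [[i [act [st' []]]]].
rewrite cons_uniq => /andP[ks us].
rewrite -[memory (k :: s) v]/(Par pred0 (cterm k (v k)) (memory s v)) pstep_par0.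
have {}IH := IH _ _ us; split.
  case=> [[P' /pstep_cterm [act [st' [-> h ->]]] ->]
         | [P' /IH [i [act [st' [si -> h ->]]]] ->]].
    by exists k, act, st'; rewrite mem_head /= memory_upd_notin // ffunE eqxx.
  exists i, act, st'; rewrite inE si orbT /= ffunE; split=> //.
  by case: eqP ks => // ->; rewrite si.
case=> i [act [st' [+ -> h ->]]]; rewrite inE /= ffunE.
case: (eqVneq i k) h => [-> | ik] h /= si.
  left; exists (cterm k st'); first by apply/pstep_cterm; exists act, st'.
  by rewrite memory_upd_notin.
right; exists (memory s (upd v i st')) => //.
by apply/IH; exists i, act, st'.
Qed.

Lemma pterm_memory s v : pterm (memory s v).
Proof. by elim: s => //= i s ->; rewrite pterm_cterm. Qed.

(** * Finite control and relay *)

Local Notation instr := (option A + I * bool)%type.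

Variables (delta : Q -> seq (instr * Q)) (fin : pred Q) (qs : seq Q).

Definition instr_label (x : instr) : label :=
  match x with inl a => omap Obs a | inr c => send (inr c) end.

(* Iteration alone cannot express an arbitrary transition graph, so the control loop
   hands its next state to a relay, restarts, and receives the state back. *)
Definition goto (q : Q) : proc := Prefix (send (inl (inl q))) One.

Definition body (q : Q) : proc :=
  Alt (choice (delta q) (fun z => Prefix (instr_label z.1) (goto z.2)))
      (if fin q then One else Zero).

Definition control : proc :=
  Star (choice qs (fun q => Prefix (recv (inl (inr q))) (body q))).

Definition relay : proc :=
  Star (choice qs (fun q => Prefix (recv (inl (inl q)))
                              (Prefix (send (inl (inr q))) One))).

Definition environment (r : proc) (v : cstates) : proc :=
  Par pred0 (Seq r relay) (memory (enum I) v).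

(** Over [predT] every communication must be matched across the two sides; relay and counters,
    composed over [pred0], never talk to each other. *)
Definition system (c r : proc) (v : cstates) : proc :=
  Par predT (Seq c control) (environment r v).

Definition at_state q v := system (body q) One v.
Definition leaving q v := system (goto q) One v.
Definition relaying q v := system One (Prefix (send (inl (inr q))) One) v.

Lemma pstep_body q a P : pstep (body q) a P <->
  exists x q', [/\ (x, q') \in delta q, a = instr_label x & P = goto q'].
Proof.
split=> [[/pstep_choice [[x q'] xq [-> ->]] | ] | [x [q' [xq -> ->]]]].
- by exists x, q'.
- by case: (fin q).
- by left; apply/pstep_choice; exists (x, q').
Qed.

Lemma pterm_body q : pterm (body q) = fin q.
Proof. by rewrite /= pterm_choice_prefix /=; case: (fin q). Qed.

Lemma pstep_control a P : pstep control a P <->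
  exists2 q, q \in qs & a = recv (inl (inr q)) /\ P = Seq (body q) control.
Proof.
split=> [[P' [/pstep_choice [q qq [-> ->]] ->]] | [q qq [-> ->]]]; first by exists q.
by exists (body q); split=> //; apply/pstep_choice; exists q.
Qed.

Lemma pstep_relay a P : pstep relay a P <->
  exists2 q, q \in qs & a = recv (inl (inl q)) /\
    P = Seq (Prefix (send (inl (inr q))) One) relay.
Proof.
split=> [[P' [/pstep_choice [q qq [-> ->]] ->]] | [q qq [-> ->]]]; first by exists q.
by exists (Prefix (send (inl (inr q))) One); split=> //; apply/pstep_choice; exists q.
Qed.

Lemma pstep_seq_prefix (b : label) P1 P2 a P :
  pstep (Seq (Prefix b P1) P2) a P <-> a = b /\ P = Seq P1 P2.
Proof.
rewrite pstep_seq_live; last by exists b, P1.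
by split=> [[P' [-> ->] ->] | [-> ->]] //; exists P1.
Qed.

Lemma pstep_environment_idle v a P : pstep (environment One v) a P <->
  (exists2 q, q \in qs & a = recv (inl (inl q)) /\
     P = environment (Prefix (send (inl (inr q))) One) v) \/
  (exists i act st', [/\ a = recv (inr (i, act)), cstep (v i) act = Some st'
                       & P = environment One (upd v i st')]).
Proof.
rewrite pstep_par0; split=> [[[P'] | [P']] | [[q qq [-> ->]] | [i [act [st' [-> h ->]]]]]].
- by rewrite pstep_seq_one => /pstep_relay [q qq [-> ->]] ->; left; exists q.
- move=> /pstep_memory -/(_ (enum_uniq _)) [i [act [st' [_ -> h ->]]]] ->.
  by right; exists i, act, st'.
- left; exists (Seq (Prefix (send (inl (inr q))) One) relay) => //.
  by rewrite pstep_seq_one; apply/pstep_relay; exists q.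
- right; exists (memory (enum I) (upd v i st')) => //.
  apply/pstep_memory; first exact: enum_uniq.
  by exists i, act, st'; rewrite mem_enum.
Qed.

Lemma pstep_environment_busy q v a P :
  pstep (environment (Prefix (send (inl (inr q))) One) v) a P <->
  (a = send (inl (inr q)) /\ P = environment One v) \/
  (exists i act st', [/\ a = recv (inr (i, act)), cstep (v i) act = Some st'
     & P = environment (Prefix (send (inl (inr q))) One) (upd v i st')]).
Proof.
rewrite pstep_par0; split=> [[[P'] | [P']] | [[-> ->] | [i [act [st' [-> h ->]]]]]].
- by rewrite pstep_seq_prefix => -[-> ->] ->; left.
- move=> /pstep_memory -/(_ (enum_uniq _)) [i [act [st' [_ -> h ->]]]] ->.
  by right; exists i, act, st'.
- by left; exists (Seq One relay) => //; rewrite pstep_seq_prefix.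
- right; exists (memory (enum I) (upd v i st')) => //.
  apply/pstep_memory; first exact: enum_uniq.
  by exists i, act, st'; rewrite mem_enum.
Qed.

(** The second case arises when the body terminates without any step, so that the iteration may
    restart; it then waits for the relay, which sends nothing while idle. *)
Lemma pstep_at_control q a P : pstep (Seq (body q) control) a P ->
  (exists x q', [/\ (x, q') \in delta q, a = instr_label x
                  & P = Seq (goto q') control]) \/
  exists q', a = recv (inl (inr q')).
Proof.
case=> [[P' [/pstep_body [x [q' [xq -> ->]]] ->]] | [_ /pstep_control [q' _ [-> _]] _]].
  by left; exists x, q'.
by right; exists q'.
Qed.

Lemma pstep_at_state q v a P : pstep (at_state q v) a P <->
  (exists x q', [/\ (inl x, q') \in delta q, a = omap Obs x & P = leaving q' v]) \/
  (exists i act q' st', [/\ a = None, (inr (i, act), q') \in delta q,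
     cstep (v i) act = Some st' & P = leaving q' (upd v i st')]).
Proof.
split; last first.
  case=> [[x [q' [xq -> ->]]] | [i [act [q' [st' [-> xq h ->]]]]]].
    apply: Or31; exists (Seq (goto q') control); split=> //; last by case: x xq.
    by left; exists (goto q'); split=> //; apply/pstep_body; exists (inl x), q'.
  apply: Or33; split=> //.
  exists (pickle (inr (i, act) : chan)), e0, (Seq (goto q') control),
    (environment One (upd v i st')); split=> //; right; split.
    left; exists (goto q'); split=> //; apply/pstep_body.
    by exists (inr (i, act)), q'.
  by apply/pstep_environment_idle; right; exists i, act, st'.
case.
- case=> P' [/pstep_at_control [[[x|c] [q' [xq -> ->]]] | [q' ->]]] // _ ->.
  by left; exists x, q'.
- by case=> P' [/pstep_environment_idle [[q' _ [-> _]] | [i [act [st' [->]]]]]].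
- case=> -> [c [d [P1 [P2 [_ + ->]]]]].
  (* The idle environment only receives, so the control must be the sender. *)
  case=> [[_ /pstep_environment_idle [[? _ [//]] | [? [? [? [//]]]]]]|].
  case=> /pstep_at_control [[[[x|]|[i act]] [q' [xq // + ->]]] | [q' //]].
  move=> /send_recv_eq inj /pstep_environment_idle [[q2 _ [/inj //]] | ].
  case=> i' [act' [st' [/inj [<- <-] h ->]]].
  by right; exists i, act, q', st'.
Qed.

Lemma pstep_leaving q v a P : q \in qs ->
  (pstep (leaving q v) a P <-> a = None /\ P = relaying q v).
Proof.
move=> qq; split; last first.
  case=> -> ->; apply: Or33; split=> //.
  exists (pickle (inl (inl q) : chan)), e0, (Seq One control),
    (environment (Prefix (send (inl (inr q))) One) v); split=> //; right; split.
    exact/pstep_seq_prefix.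
  by apply/pstep_environment_idle; left; exists q.
case.
- by case=> P' [/pstep_seq_prefix [-> _]].
- by case=> P' [/pstep_environment_idle [[q' _ [-> _]] | [i [act [st' [->]]]]]].
- case=> -> [c [d [P1 [P2 [_ + ->]]]]].
  case=> [[/pstep_seq_prefix [//]] | [/pstep_seq_prefix [/send_recv_eq inj ->]]].
  case/pstep_environment_idle=> [[q2 _ [/inj [<-] ->]] // | ].
  by case=> i [act [st' [/inj]]].
Qed.

Lemma pstep_relaying q v a P : q \in qs ->
  (pstep (relaying q v) a P <-> a = None /\ P = at_state q v).
Proof.
move=> qq; split; last first.
  case=> -> ->; apply: Or33; split=> //.
  exists (pickle (inl (inr q) : chan)), e0, (Seq (body q) control),
    (environment One v); split=> //; left; split.
    by apply/pstep_seq_one/pstep_control; exists q.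
  by apply/pstep_environment_busy; left.
case.
- by case=> P' [/pstep_seq_one /pstep_control [q' _ [-> _]]].
- by case=> P' [/pstep_environment_busy [[-> _] | [i [act [st' [->]]]]]].
- case=> -> [c [d [P1 [P2 [_ + ->]]]]].
  case=> -[/pstep_seq_one /pstep_control [q' _ [e ->]]]; last by [].
  case/pstep_environment_busy=> [[e' ->] | [i [act [st' [//]]]]].
  by case: (send_recv_eq e' e) => ->.
Qed.

Lemma pterm_at_state q v : pterm (at_state q v) = fin q.
Proof.
by rewrite [LHS]/= -[X in (X && _) && _]/(pterm (body q)) pterm_body pterm_memory !andbT.
Qed.

Lemma inev_leaving G q (v : cstates) : q \in qs -> inev G (at_state q v) -> inev G (leaving q v).
Proof.
move=> qq iq; apply: inev_tau => //.
- by exists (relaying q v); apply/pstep_leaving.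
- by move=> a P' /pstep_leaving -/(_ qq) [].
move=> P' /pstep_leaving -/(_ qq) [_ ->]; apply: inev_tau => //.
- by exists (at_state q v); apply/pstep_relaying.
- by move=> a P2 /pstep_relaying -/(_ qq) [].
- by move=> P2 /pstep_relaying -/(_ qq) [_ ->].
Qed.

Lemma inev_at_state G q (v : cstates) : ~~ fin q ->
  (forall x q', (inl x, q') \notin delta q) ->
  (exists i act q' st', (inr (i, act), q') \in delta q /\ cstep (v i) act = Some st') ->
  (forall i act q' st', (inr (i, act), q') \in delta q -> cstep (v i) act = Some st' ->
     q' \in qs /\ inev G (at_state q' (upd v i st'))) ->
  inev G (at_state q v).
Proof.
move=> nf no [i [act [q' [st' [h1 h2]]]]] next; apply: inev_tau.
- by rewrite pterm_at_state.
- by exists (leaving q' (upd v i st')); apply/pstep_at_state; right; exists i, act, q', st'.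
- move=> a P' /pstep_at_state [[x [q2 [h]]] | [? [? [? [? [//]]]]]].
  by have := no x q2; rewrite h.
- move=> P' /pstep_at_state [[x [q2 [h]]] | [i2 [act2 [q2 [st2 [_ g1 g2 ->]]]]]].
    by have := no x q2; rewrite h.
  by have [qq iq] := next _ _ _ _ g1 g2; apply: inev_leaving.
Qed.

End CounterMachine.

(** * Head moves as counter programs *)

Section Simulation.

Variables (A D : finType) (M : rtm A D).
Local Notation S := (rtm_state M).

Definition symbols : seq (option D) := None :: map Some (enum D).
Definition base := size symbols.
Definition code (x : option D) : nat := index x symbols.
Definition symbol (n : nat) : option D := nth None symbols n.

Lemma mem_symbols x : x \in symbols.
Proof. by case: x => [x|] //; rewrite inE mem_map ?mem_enum // => y z []. Qed.

Lemma codeK : cancel code symbol.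
Proof. by move=> x; rewrite /symbol nth_index ?mem_symbols. Qed.

Lemma code_lt x : code x < base.
Proof. by rewrite index_mem mem_symbols. Qed.

Definition num : seq (option D) -> nat := foldr (fun x n => code x + base * n) 0.

Lemma num_head w : symbol (num w %% base) = head None w.
Proof.
case: w => [|x w] /=; first by rewrite mod0n.
by rewrite mulnC addnC modnMDl modn_small ?code_lt // codeK.
Qed.

Lemma num_behead w : num w %/ base = num (behead w).
Proof.
case: w => [|x w] /=; first by rewrite div0n.
by rewrite mulnC addnC divnMDl // divn_small ?code_lt // addn0.
Qed.

(* A job drains the counter [job_src] and, for every [job_div] units removed, adds
   [job_mul] units to [job_dst], to which [job_add] is added beforehand.  A head
   move is four jobs in a row: [inl (inl e)] pushes e onto the stack in counter
   [Some m] with the result left in the scratch counter [None], [inr false] copies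
   it back, [inr true] divides the stack in counter [Some (~~ m)] by the base,
   leaving the popped symbol d as remainder, and [inl (inr d)] copies it back. *)
Local Notation job := (S * bool * (option D + option D + bool))%type.
(* [inl (s, d)]: machine state s with d under the head.  [inr (j, None)]: about to
   start job j.  [inr (j, Some (i, r))]: running j, with i units still to be added to
   the target and r units drained since the last complete group of [job_div j]. *)
Local Notation ctl := (S * option D + job * option (nat * nat))%type.
Local Notation cnt := (option bool).

Definition job_src (j : job) : cnt :=
  match j.2 with
  | inl (inl _) => Some j.1.2
  | inr true => Some (~~ j.1.2)
  | _ => None
  end.

Definition job_dst (j : job) : cnt :=
  match j.2 with
  | inr false => Some j.1.2
  | inl (inr _) => Some (~~ j.1.2)
  | _ => None
  end.

Definition job_div (j : job) : nat := if j.2 is inr true then base else 1.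
Definition job_mul (j : job) : nat := if j.2 is inl (inl _) then base else 1.
Definition job_add (j : job) : nat := if j.2 is inl (inl e) then code e else 0.

Definition job_next (j : job) (r : nat) : ctl :=
  match j.2 with
  | inl (inl _) => inr ((j.1, inr false), None)
  | inr false => inr ((j.1, inr true), None)
  | inr true => inr ((j.1, inl (inr (symbol r))), None)
  | inl (inr d) => inl (j.1.1, d)
  end.

Definition to_move (m : bool) : move := if m then MoveR else MoveL.

(** At [Some (0, r)] the two instructions exclude each other: a counter in down mode accepts [true]
    only when positive and [false] only at zero, which also returns it to up mode. *)
Definition ctl_delta (q : ctl) : seq ((option A + cnt * bool) * ctl) :=
  match q with
  | inl (s, d) =>
      [seq (inl y.1.1.1, inr ((y.2, y.1.2, inl (inl y.1.1.2)), None))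
         | y <- enum {: option A * option D * bool * S}
         & rtm_trans s d y.1.1.1 y.1.1.2 (to_move y.1.2) y.2]
  | inr (j, None) => [:: (inr (job_src j, false), inr (j, Some (job_add j, 0)))]
  | inr (j, Some (i.+1, r)) => [:: (inr (job_dst j, true), inr (j, Some (i, r)))]
  | inr (j, Some (0, r)) =>
      [:: (inr (job_src j, true),
           inr (j, Some (if r.+1 < job_div j then (0, r.+1) else (job_mul j, 0))));
          (inr (job_src j, false), job_next j r)]
  end.

Definition ctl_final (q : ctl) : bool := if q is inl (s, _) then rtm_final s else false.

(** [ctl] is infinite, but pending amounts up to [base] and remainders below [base] suffice for all
    jobs. *)
Definition ctl_states : seq ctl :=
  [seq inl x | x <- enum {: S * option D}] ++
  [seq inr (y.1, omap (fun p => (val p.1, val p.2)) y.2)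
     | y <- enum {: job * option ('I_base.+1 * 'I_base)}].

Lemma mem_ctl_config x : inl x \in ctl_states.
Proof. by rewrite mem_cat; apply/orP; left; apply/mapP; exists x; rewrite ?mem_enum. Qed.

Lemma mem_ctl_switch j : inr (j, None) \in ctl_states.
Proof.
rewrite mem_cat; apply/orP; right; apply/mapP.
by exists (j, None); rewrite ?mem_enum.
Qed.

Lemma mem_ctl_work j i r : i <= base -> r < base -> inr (j, Some (i, r)) \in ctl_states.
Proof.
move=> ib rb; rewrite mem_cat; apply/orP; right; apply/mapP.
have ib' : i < base.+1 by [].
by exists (j, Some (Ordinal ib', Ordinal rb)); rewrite ?mem_enum.
Qed.

Lemma mem_job_next j r : job_next j r \in ctl_states.
Proof.
by case: j => -[t m] [[e|d]|[]]; rewrite ?mem_ctl_switch ?mem_ctl_config.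
Qed.

Lemma job_dst_src j : (job_dst j == job_src j) = false.
Proof. by case: j => -[t m] [[e|d]|[]]. Qed.

Lemma job_div_le j : 0 < job_div j <= base.
Proof. by case: j => -[t m] [[e|d]|[]] /=; rewrite ?leqnn. Qed.

Lemma job_mul_le j : job_mul j <= base.
Proof. by case: j => -[t m] [[e|d]|[]] /=; rewrite ?leqnn. Qed.

Lemma job_add_le j : job_add j <= base.
Proof. by case: j => -[t m] [[e|d]|[]] //=; rewrite ltnW ?code_lt. Qed.

(** * Correctness of the jobs *)

Local Notation pr := (proc A nat (option D)).
Local Notation at_q := (@at_state A (option D) None ctl cnt ctl_delta ctl_final ctl_states).

Lemma inev_put (G : pr -> Prop) j i r m (v : {ffun cnt -> cstate}) :
  v (job_dst j) = (true, m) -> i < base -> r < base ->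
  inev G (at_q (inr (j, Some (i, r))) (upd v (job_dst j) (true, m.+1))) ->
  inev G (at_q (inr (j, Some (i.+1, r))) v).
Proof.
move=> vd ib rb iG; apply: inev_at_state => //.
  by exists (job_dst j), true, (inr (j, Some (i, r))), (true, m.+1); rewrite vd mem_head.
move=> k act q' st'; rewrite inE => /eqP [-> -> ->]; rewrite vd => -[<-].
by rewrite mem_ctl_work // ltnW.
Qed.

(** The predicted target value and the remainder [(n + r) %% job_div j] are invariant while the job
    runs, so [w] stays fixed. Induction on [n] encloses that on [i] because draining a unit may
    reset [i] to [job_mul j]. *)
Lemma inev_work (G : pr -> Prop) j n i r m (v w : {ffun cnt -> cstate}) :
  v (job_src j) = (false, n) -> v (job_dst j) = (true, m) ->
  i <= base -> r < job_div j ->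
  (forall k, w k = if k == job_dst j
     then (true, m + i + job_mul j * ((n + r) %/ job_div j))
     else if k == job_src j then (true, 0) else v k) ->
  inev G (at_q (job_next j ((n + r) %% job_div j)) w) ->
  inev G (at_q (inr (j, Some (i, r))) v).
Proof.
have /andP[p0 pb] := job_div_le j; have sd := job_dst_src j.
elim: n i r m v => [|n IHn] i r m v; elim: i m v => [|i IHi] m v vs vd ib rp we iw.
- apply: inev_at_state => //.
    by exists (job_src j), false, (job_next j r), (true, 0); rewrite vs !inE eqxx orbT.
  move=> k act q' st'; rewrite !inE => /orP[] /eqP [-> -> ->]; rewrite vs //= => -[<-].
  rewrite mem_job_next; split=> //.
  rewrite modn_small in iw => //; suff -> : upd v (job_src j) (true, 0) = w by [].
  apply/ffunP=> c; rewrite we ffunE divn_small // muln0 !addn0.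
  by case: (eqVneq c (job_dst j)) => [->|//]; rewrite sd vd.
- apply: (inev_put vd ib) (leq_trans rp pb) _.
  apply: (IHi m.+1) => //; [by rewrite ffunE eq_sym sd | by rewrite ffunE eqxx | exact: ltnW |].
  by move=> c; rewrite we ffunE (addSnnS m); case: eqP.
- apply: inev_at_state => //.
    by exists (job_src j), true; do 2!eexists; split; [exact: mem_head | rewrite vs].
  move=> k act q' st'; rewrite !inE => /orP[] /eqP [-> -> ->]; rewrite vs //= => -[<-].
  set v' := upd _ _ _.
  have vs' : v' (job_src j) = (false, n) by rewrite ffunE eqxx.
  have vd' : v' (job_dst j) = (true, m) by rewrite ffunE sd.
  have we' c x : (if c == job_src j then x else v c) = if c == job_src j then x else v' c.
    by rewrite ffunE; case: eqP.
  (* The drained unit either joins the current group, moving one unit from [n] to [r], or completes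
     it: [r] restarts at 0 and the quotient drops by one in exchange for [job_mul j] pending
     units. *)
  case: ltnP => rp'.
    rewrite mem_ctl_work ?(leq_trans rp') //; split=> //.
    apply: (IHn 0 r.+1 m) => //; last by rewrite -addSnnS.
    by move=> c; rewrite we addSnnS we'.
  have {rp'} er : r.+1 = job_div j by apply/eqP; rewrite eqn_leq rp rp'.
  have en : n.+1 + r = job_div j + n by rewrite addSnnS er addnC.
  rewrite mem_ctl_work ?job_mul_le ?(leq_trans p0) //; split=> //.
  apply: (IHn (job_mul j) 0 m) => //; first exact: job_mul_le.
    move=> c; rewrite we en we' addn0 divnDl // divnn p0 mulnDr muln1 addn0.
    by rewrite addnA.
  by rewrite addn0 -(modnDl n) -en.
- apply: (inev_put vd ib) (leq_trans rp pb) _.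
  apply: (IHi m.+1) => //; [by rewrite ffunE eq_sym sd | by rewrite ffunE eqxx | exact: ltnW |].
  by move=> c; rewrite we ffunE (addSnnS m); case: eqP.
Qed.

Lemma inev_job (G : pr -> Prop) j n m (v w : {ffun cnt -> cstate}) :
  v (job_src j) = (true, n) -> v (job_dst j) = (true, m) ->
  (forall k, w k = if k == job_dst j
     then (true, m + job_add j + job_mul j * (n %/ job_div j))
     else if k == job_src j then (true, 0) else v k) ->
  inev G (at_q (job_next j (n %% job_div j)) w) ->
  inev G (at_q (inr (j, None)) v).
Proof.
have /andP[p0 pb] := job_div_le j; have sd := job_dst_src j.
move=> vs vd we iw; apply: inev_at_state => //.
  by exists (job_src j), false; do 2!eexists; split; [exact: mem_head | rewrite vs].
move=> k act q' st'; rewrite inE => /eqP [-> -> ->]; rewrite vs => -[<-].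
rewrite mem_ctl_work ?job_add_le //; split=> //.
apply: (@inev_work _ _ n _ 0 m _ w); rewrite ?ffunE ?eqxx ?sd ?addn0 //.
  exact: job_add_le.
by move=> c; rewrite we ffunE; case: (c == job_src j).
Qed.

(* Counter [Some true] holds the left part of the tape, [Some false] the right part. *)
Definition counters (m : bool) (x y z : nat) : {ffun cnt -> cstate} :=
  [ffun k => (true, if k is Some c then if c == m then x else y else z)].

Lemma counters_sym m x y z : counters (~~ m) y x z = counters m x y z.
Proof. by apply/ffunP=> -[[]|]; rewrite !ffunE; case: m. Qed.

Lemma inev_tape_step (G : pr -> Prop) t m e x y :
  inev G (at_q (inl (t, symbol (y %% base)))
               (counters m (code e + base * x) (y %/ base) 0)) ->
  inev G (at_q (inr ((t, m, inl (inl e)), None)) (counters m x y 0)).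
Proof.
have nm c : (c == ~~ m) = ~~ (c == m) by case: c; case: m.
move=> iG.
apply: (@inev_job _ _ x 0 _ (counters m 0 y (code e + base * x))).
- by rewrite ffunE /= eqxx.
- by rewrite ffunE.
- move=> [c|]; rewrite !ffunE /= ?divn1 //.
  by rewrite -[Some c == _]/(c == m); case: eqP.
apply: (@inev_job _ _ (code e + base * x) 0 _ (counters m (code e + base * x) y 0)).
- by rewrite ffunE.
- by rewrite ffunE /= eqxx.
- move=> [c|]; rewrite !ffunE //= -[Some c == _]/(c == m) divn1 mul1n !add0n.
  by case: eqP.
(* The quotient goes to the scratch counter, while the remainder [y %% base] travels through the
   control as the popped symbol. *)
apply: (@inev_job _ _ y 0 _ (counters m (code e + base * x) 0 (y %/ base))).
- by rewrite ffunE /=; case: (m).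
- by rewrite ffunE.
- move=> [c|]; rewrite !ffunE /= ?mul1n //.
  by rewrite -[Some c == _]/(c == ~~ m) nm; case: eqP.
apply: (@inev_job _ _ (y %/ base) 0 _
         (counters m (code e + base * x) (y %/ base) 0)) => //.
- by rewrite ffunE.
- by rewrite ffunE /=; case: (m).
- move=> [c|]; rewrite !ffunE //= -[Some c == _]/(c == ~~ m) divn1 mul1n !add0n nm.
  by case: eqP.
Qed.

(** * Encoding of machine configurations *)

(** The left part is reversed so that the symbol next to the head is the least significant digit,
    the top of the stack. *)
Definition encodes (x : rtm_config M) (P : pr) : Prop :=
  let: (s, Tape l d r) := x in
  P = at_q (inl (s, d)) (counters true (num (rev l)) (num r) 0).

Lemma inev_moveR t e l r :
  inev (encodes (t, tape_moveR (rcons l e) r))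
    (at_q (inr ((t, true, inl (inl e)), None)) (counters true (num (rev l)) (num r) 0)).
Proof.
apply: inev_tape_step; apply: inev_now; rewrite num_head num_behead.
by case: r => [|x r] /=; rewrite rev_rcons.
Qed.

Lemma inev_moveL t e l r :
  inev (encodes (t, tape_moveL l (e :: r)))
    (at_q (inr ((t, false, inl (inl e)), None)) (counters true (num (rev l)) (num r) 0)).
Proof.
(* With the two stacks exchanged, a left move is the same push and pop as a right move. *)
rewrite -counters_sym; apply: inev_tape_step; apply: inev_now; rewrite num_head num_behead.
rewrite (counters_sym true).
by case: l => [|x l] //; rewrite [tape_moveL _ _]/= (lastI x l) rev_rcons.
Qed.

Lemma encodes_fwd x P : encodes x P -> forall a y, rtm_step x a y ->
  exists2 P', pstep P (omap Obs a) P' & inev (encodes y) P'.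
Proof.
case: x => s [l d r] -> a y [e [t st]].
pose v := counters true (num (rev l)) (num r) 0.
have go m : rtm_trans s d a e (to_move m) t ->
    inev (encodes y) (at_q (inr ((t, m, inl (inl e)), None)) v) ->
    exists2 P', pstep (at_q (inl (s, d)) v) (omap Obs a) P' & inev (encodes y) P'.
  move=> tr iy; eexists; last by apply: inev_leaving iy; apply: mem_ctl_switch.
  apply/pstep_at_state; left; exists a; eexists; split=> //.
  by apply/mapP; exists (a, e, m, t); rewrite // mem_filter mem_enum tr.
case: st => -[tr ey]; rewrite ey in go *.
  by apply: (go false) => //; apply: inev_moveL.
by apply: (go true) => //; apply: inev_moveR.
Qed.

(** Control states holding a configuration have no counter instructions, so each step performs the
    action of a machine transition. *)
Lemma encodes_bwd x P : encodes x P -> forall b P', pstep P b P' ->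
  exists a y, [/\ b = omap Obs a, rtm_step x a y & inev (encodes y) P'].
Proof.
case: x => s [l d r] -> b P' /pstep_at_state [].
  case=> a [q' [/mapP [[[[a' e] m] t]]]].
  rewrite mem_filter => /andP[/= tr _] [-> ->] -> ->.
  case: m tr => tr.
    exists a', (t, tape_moveR (rcons l e) r).
    split=> //; [by exists e, t; right | exact/inev_leaving/inev_moveR/mem_ctl_switch].
  exists a', (t, tape_moveL l (e :: r)).
  split=> //; [by exists e, t; left | exact/inev_leaving/inev_moveL/mem_ctl_switch].
by case=> i [act [q' [st' [_ /mapP [? _ //]]]]].
Qed.

End Simulation.

Theorem theorem3 (A D : finType) (M : rtm A D) :
  exists P : proc A nat (option D),
    dp_branching_bisimilar (rtm_tsys nat (option D) M) (proc_tsys P).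
Proof.
(* The witness stays open until the last goal fixes it as the encoding of the initial
   configuration. *)
eexists; apply: (@inev_bisimilar _ _ _ (rtm_tsys nat (option D) M) (@encodes _ _ M)).
- move=> x P eP _ y [a [-> st]]; exact: encodes_fwd st.
- move=> x P eP b P' st; have [a [y [-> sx iy]]] := encodes_bwd eP st.
  by exists y => //; exists a.
- by move=> [s [l d r]] P ->; rewrite pterm_at_state.
- exact: inev_now.
Qed.
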